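(* Let $n,m\ge 1$ be integers. The map $$\mathcal{E}:\operatorname{Sym}^n(\mathbb{C}^m)\to\operatorname{Hom}(\mathbb{C}[u_1,\ldots,u_m],\mathbb{C}),\qquad \mathcal{E}(x_1,\ldots,x_n)(p)=p(x_1)+\ldots+p(x_n),$$ defines a homeomorphism $\mathcal{E}:\operatorname{Sym}^n(\mathbb{C}^m)\to\Phi_n(m)$ onto the set $\Phi_n(m)$ of all Frobenius $n$-homomorphisms $\mathbb{C}[u_1,\ldots,u_m]\to\mathbb{C}$.
   Context: For a space $X$, $\operatorname{Sym}^n(X)=X^n/S_n$ is the quotient space of $X^n$ by the action of the symmetric group $S_n$ permuting coordinates. For a commutative $\mathbb{C}$-algebra $A$ with unit, $\operatorname{Hom}(A,\mathbb{C})$ denotes the linear space of all $\mathbb{C}$-linear maps $A\to\mathbb{C}$, with coordinate functions $f\mapsto f(a)$, $a\in A$; it carries the topology of pointwise convergence (the coarsest topology making all these coordinate functions continuous), and subsets carry the subspace topology. For a linear map $f:A\to\mathbb{C}$, linear maps $\Phi_n(f):A^{\otimes n}\to\mathbb{C}$ are defined by $\Phi_1(f)=f$, $\Phi_2(f)(a_1\otimes a_2)=f(a_1)f(a_2)-f(a_1a_2)$ and recursively $$\Phi_{n+1}(f)(a_1\otimes\ldots\otimes a_{n+1})=f(a_1)\Phi_n(f)(a_2\otimes\ldots\otimes a_{n+1})-\sum_{j=2}^{n+1}\Phi_n(f)(a_2\otimes\ldots\otimes a_1a_j\otimes\ldots\otimes a_{n+1}),$$ where in the $j$-th summand $a_j$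 is replaced by $a_1a_j$. A Frobenius $n$-homomorphism is a linear map $f:A\to\mathbb{C}$ with $f(1)=n$ and $\Phi_{n+1}(f)\equiv 0$. $\Phi_n(m)\subset\operatorname{Hom}(\mathbb{C}[u_1,\ldots,u_m],\mathbb{C})$ is the set of all Frobenius $n$-homomorphisms of $A=\mathbb{C}[u_1,\ldots,u_m]$. *)

(* Defs.v *)
From HB Require Import structures.
From mathcomp Require Import all_boot all_order all_algebra all_fingroup.
From mathcomp Require Import generic_quotient complex.
From mathcomp Require Import all_classical all_reals topology.
(* The notations of mpoly clash with those of mathcomp-analysis. *)
From mathcomp Require Import -(notations) mpoly.

Set Implicit Arguments.
Unset Strict Implicit.
Unset Printing Implicit Defensive.

Import Order.TTheory GRing.Theory Num.Theory.
Local Open Scope classical_set_scope.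
Local Open Scope quotient_scope.
Local Open Scope ring_scope.
Local Open Scope complex_scope.

(* Balls of R[i] are those of the modulus `|x - y|; R[i]^o already has them.   *)
HB.instance Definition _ (R : realType) := PseudoPointedMetric.copy R[i] R[i]^o.

Definition homeomorphism (X Y : topologicalType) (h : X -> Y) : Prop :=
  exists g : Y -> X,
    [/\ cancel h g, cancel g h, continuous h & continuous g].

Section SymmetricPower.
Variables (n : nat) (X : topologicalType).

Definition perm_related (x y : {ptws 'I_n -> X}) : bool :=
  `[< exists s : 'S_n, y = (x \o s : 'I_n -> X) >].

Lemma perm_related_equiv : equiv_class_of perm_related.
Proof.
split.
- by move=> x; apply/asboolP; exists 1%g; apply/funext => i /=; rewrite perm1.
- move=> x y; apply/asboolP/asboolP => -[s ->]; exists s^-1%g;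
    by apply/funext => i /=; rewrite permKV.
- move=> y x z /asboolP[s ->] /asboolP[t ->]; apply/asboolP.
  by exists (t * s)%g; apply/funext => i /=; rewrite permM.
Qed.

Canonical perm_related_equivRel := EquivRelPack perm_related_equiv.

Definition symPower : Type := quotient_topology {eq_quot perm_related_equivRel}.

HB.instance Definition _ := Topological.on symPower.
HB.instance Definition _ := Quotient.on symPower.

End SymmetricPower.

Section LinearForms.
Variables (R : realType) (A : comAlgType R[i]).

Definition linform : Type := {scalar A}.

HB.instance Definition _ := gen_eqMixin linform.
HB.instance Definition _ := gen_choiceMixin linform.
HB.instance Definition _ := Topological.copy linform
  (initial_topology (fun f : linform => (f : A -> R[i]) : {ptws A -> R[i]})).

(* The linear map on the n-th tensor power of A is encoded by the multilinear  *)
(* map on A^n (see frobenius_phi_linear), i.e. by its values on pure tensors.  *)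
(* The value at n = 0 is the one for which the recursion gives Phi_1(f) = f.   *)
Fixpoint frobenius_phi (f : linform) (n : nat) : ('I_n -> A) -> R[i] :=
  match n with
  | 0 => fun _ => 1
  | k.+1 => fun a =>
      let b := fun j : 'I_k => a (lift ord0 j) in
      f (a ord0) * frobenius_phi f b
      - \sum_(j < k) frobenius_phi f (dfwith b j (a ord0 * b j) : 'I_k -> A)
  end.

Definition frobenius_homs (n : nat) : set linform :=
  [set f : linform | f 1 = n%:R /\ forall a : 'I_n.+1 -> A, frobenius_phi f a = 0].

Lemma frobenius_phi1 (f : linform) (a : 'I_1 -> A) :
  frobenius_phi f a = f (a ord0).
Proof. by rewrite /= big_ord0 mulr1 subr0. Qed.

Lemma frobenius_phi2 (f : linform) (a : 'I_2 -> A) :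
  frobenius_phi f a = f (a ord0) * f (a ord_max) - f (a ord0 * a ord_max).
Proof.
rewrite /= big_ord1 !big_ord0 !mulr1 !subr0 dfwithin.
by rewrite (_ : lift ord0 ord0 = ord_max)//; apply: val_inj.
Qed.

Lemma frobenius_phi_linear (f : linform) (n : nat) (a : 'I_n -> A) (i : 'I_n) :
  scalar (fun x : A => frobenius_phi f (dfwith a i x)).
Proof.
elim: n => [|n IHn] in a i *; first by case: i.
have phiS (d : 'I_n.+1 -> A) (b : 'I_n -> A) :
    (forall j, d (lift ord0 j) = b j) ->
    frobenius_phi f d = f (d ord0) * frobenius_phi f b
      - \sum_(j < n) frobenius_phi f (dfwith b j (d ord0 * b j)).
  by move=> /funext <-.
pose b (j : 'I_n) := a (lift ord0 j).
move=> c x y; case: (unliftP ord0 i) => [k|] ->; last first.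
  rewrite !(phiS _ b); do ?by move=> j; rewrite dfwithout.
  rewrite !dfwithin linearP mulrDl mulrBr -mulrA addrACA -opprD.
  rewrite mulr_sumr -big_split; congr (_ - _); apply: eq_bigr => j _ /=.
  by rewrite mulrDl -scalerAl IHn.
have dfk z j : dfwith a (lift ord0 k) z (lift ord0 j) = dfwith b k z j.
  have [<-|kj] := eqVneq k j; first by rewrite !dfwithin.
  by rewrite !dfwithout// (inj_eq lift_inj).
rewrite !(phiS _ _ (dfk _)) !(@dfwithout _ _ _ (lift ord0 k) _ ord0)//.
rewrite IHn mulrDr mulrBr (mulrCA _ c) addrACA -opprD.
rewrite mulr_sumr -big_split; congr (_ - _); apply: eq_bigr => j _ /=.
have [->|jk] := eqVneq j k.
  have E z w : dfwith (dfwith b k z) k w = dfwith b k w.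
    apply/funext => l; have [<-|kl] := eqVneq k l; first by rewrite !dfwithin.
    by rewrite !dfwithout.
  by rewrite !E !dfwithin mulrDr -scalerAr IHn.
have E z : dfwith (dfwith b k z) j (a ord0 * dfwith b k z j) =
           dfwith (dfwith b j (a ord0 * b j)) k z.
  rewrite [dfwith b k z j]dfwithout 1?eq_sym//.
  apply/funext => l; have [<-|jl] := eqVneq j l.
    by rewrite dfwithin dfwithout 1?eq_sym// dfwithin.
  rewrite dfwithout//; have [<-|kl] := eqVneq k l; first by rewrite !dfwithin.
  by rewrite !dfwithout.
by rewrite !E IHn.
Qed.

End LinearForms.

Section EvaluationMap.
Variables (R : realType) (n m : nat).

Definition eval_sum (x : 'I_n -> 'rV[R[i]]_m) (p : mpoly m R[i]) : R[i] :=
  \sum_(i < n) meval (x i ord0) p.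

Lemma eval_sum_scalar x : scalar (eval_sum x).
Proof.
move=> c p q; rewrite /eval_sum mulr_sumr -big_split; apply: eq_bigr => i _ /=.
by rewrite mevalD mevalZ.
Qed.

HB.instance Definition _ x :=
  GRing.isLinear.Build R[i] (mpoly m R[i]) R[i] *%R (eval_sum x)
    (eval_sum_scalar x).

Definition eval_map (z : symPower n 'rV[R[i]]_m) : linform (mpoly m R[i]) :=
  eval_sum (repr z) : {scalar mpoly m R[i]}.

Lemma eval_map_pi (x : {ptws 'I_n -> 'rV[R[i]]_m}) (p : mpoly m R[i]) :
  eval_map (\pi_(symPower n 'rV[R[i]]_m) x) p = \sum_(i < n) meval (x i ord0) p.
Proof.
have /eqmodP/asboolP[s xE] := esym (reprK (\pi_(symPower n 'rV[R[i]]_m) x)).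
rewrite /eval_map /= /eval_sum xE.
by rewrite [RHS](reindex_inj (@perm_inj _ s)).
Qed.

End EvaluationMap.

(* Main.v *)
Require Import Defs.
From mathcomp Require Import all_boot all_order all_algebra all_fingroup.
From mathcomp Require Import generic_quotient complex.
From mathcomp Require Import all_classical all_reals topology normedtype.
From mathcomp Require Import -(notations) mpoly.

Set Implicit Arguments.
Unset Strict Implicit.
Unset Printing Implicit Defensive.

Import Order.TTheory GRing.Theory Num.Theory.
Local Open Scope classical_set_scope.
Local Open Scope quotient_scope.
Local Open Scope ring_scope.
Local Open Scope complex_scope.

(** A sum of n characters of a commutative algebra is a Frobenius
    n-homomorphism: expanding the recursion, Phi_k of such a sum is the sum
    over injective k-tuples of characters, evaluated factor by factor
    (frobenius_phi_sum), and there is no injective (n+1)-tuple among n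
    characters.

    Conversely, let f be a Frobenius n-homomorphism and consider the ideal
    I of all a such that f vanishes on the multiples of a (frobenius_ker).
    Three facts reduce f to finitely many points.
    - Every a is algebraic modulo I: putting b in the first slot and a in the
      other ones, Phi_{n+1}(f)(b, a, ..., a) = f(Q(a) b) for a polynomial Q with
      leading coefficient (-1)^n n! (frobenius_phi_horner).
    - A/I is reduced: if a^2 lies in I then Phi_k(f)(a, ..., a) = f(a)^k, hence
      f(a) = 0 (frobenius_ker_sqr).
    - f takes an idempotent e of A/I to an element of {0, ..., n}, because
      Phi_{n+1}(f)(e, ..., e) = f(e) (f(e) - 1) ... (f(e) - n).
    The coordinates u_1, ..., u_m therefore satisfy modulo I one polynomial
    with simple roots. The Lagrange polynomials of the grid of its roots are
    idempotents modulo I with sum 1, so that f is the sum of the evaluations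
    at the grid points, each taken with a natural multiplicity, and the
    multiplicities add up to f(1) = n (frobenius_hom_points).

    Polynomials separate finitely many points, hence the values
    p(x_1) + ... + p(x_n) determine the multiplicity of every point
    (eq_eval_sum_perm): the map E is a continuous bijection onto the Frobenius
    n-homomorphisms.

    The continuity of the inverse is checked along ultrafilters. Let y_t be
    n-tuples of points such that E(y_t) converges to E(x). For a coordinate c,
    let g be the product of the u_c - x_{l,c}; all the power sums of the numbers
    g(y_{t,i}) tend to 0, hence so do these numbers (power_sums_cvg0), and along
    an ultrafilter one of the factors of g(y_{t,i}) tends to 0. So y_t converges
    to some n-tuple z. By continuity E(z) = E(x), and z is a permutation of x. *)

(** * The forms Phi_k and the kernel ideal of a Frobenius homomorphism *)

Section FrobeniusPhi.
Variables (R : realType) (A : comAlgType R[i]).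
Implicit Types (f : linform A) (a b : A).

#[local] Arguments frobenius_phi : simpl never.

Lemma dfwithE (I : eqType) (T : Type) (g : I -> T) i x j :
  dfwith g i x j = if j == i then x else g j.
Proof.
by have [->|ji] := eqVneq j i; rewrite ?dfwithin// dfwithout// eq_sym.
Qed.

Lemma big_dfwith (I : finType) (S : Type) (idx : S) (op : Monoid.com_law idx)
    (T : Type) (F : I -> T -> S) (g : I -> T) i x :
  \big[op/idx]_j F j (dfwith g i x j) =
  op (F i x) (\big[op/idx]_(j | j != i) F j (g j)).
Proof.
rewrite (bigD1 i)//= dfwithin; congr (op _ _).
by apply: eq_bigr => j /negPf ji; rewrite dfwithE ji.
Qed.

Lemma frobenius_phiS f k (d : 'I_k.+1 -> A) (b : 'I_k -> A) :
    (forall j, d (lift ord0 j) = b j) ->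
  frobenius_phi f d = f (d ord0) * frobenius_phi f b
    - \sum_(j < k) frobenius_phi f (dfwith b j (d ord0 * b j)).
Proof. by move=> /funext <-. Qed.

(** In the recursion, the k-tuple t receives the coefficient sum_i chi_i(a_1)
    from the product and loses chi_{t_j}(a_1) for each j; what remains is the
    sum over the characters outside of t, i.e. over the ways to extend t to an
    injective (k+1)-tuple. *)
Lemma frobenius_phi_sum n (chi : 'I_n -> A -> R[i]) f :
    (forall i, {morph chi i : x y / x * y}) ->
    (forall x, f x = \sum_i chi i x) ->
  forall k (a : 'I_k -> A), frobenius_phi f a =
    \sum_(t : k.-tuple 'I_n | uniq t) \prod_(j < k) chi (tnth t j) (a j).
Proof.
move=> chiM fE; elim=> [|k IHk] a.
  by rewrite (big_pred1 [tuple]) ?big_ord0// => t; rewrite tuple0; apply/eqP.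
pose b (j : 'I_k) := a (lift ord0 j).
rewrite (@frobenius_phiS _ _ _ b)// IHk.
under [X in _ - X]eq_bigr do rewrite IHk; rewrite exchange_big/=.
rewrite mulr_sumr -sumrB.
transitivity (\sum_(t : k.-tuple 'I_n | uniq t) \sum_(i | i \notin t)
    chi i (a ord0) * \prod_(j < k) chi (tnth t j) (b j)).
  apply: eq_bigr => t ut; rewrite -mulr_suml.
  have E j : \prod_(l < k) chi (tnth t l) (dfwith b j (a ord0 * b j) l) =
      chi (tnth t j) (a ord0) * \prod_(l < k) chi (tnth t l) (b l).
    rewrite (@big_dfwith _ _ _ _ _ (fun l => chi (tnth t l))) chiM.
    by rewrite /= -mulrA; congr (_ * _); rewrite [RHS](bigD1 j).
  under [X in _ - X]eq_bigr do rewrite E.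
  rewrite -mulr_suml -mulrBl; congr (_ * _).
  rewrite fE (bigID (mem t))/= -(big_uniq _ ut) big_tuple addrC addrK.
  by apply: eq_bigl => i.
rewrite pair_big_dep/=.
rewrite [RHS](reindex (fun p : k.-tuple 'I_n * 'I_n => [tuple of p.2 :: p.1])).
  apply: eq_big => [[t i]|[t i] _] /=; first by rewrite andbC.
  rewrite big_ord_recl tnth0; congr (_ * _); apply: eq_bigr => j _.
  by rewrite tnthS.
exists (fun t => (behead_tuple t, thead t)) => t _ /=.
- by case: t => t i /=; congr (_, _); apply: val_inj.
- by rewrite [RHS]tuple_eta; apply: val_inj.
Qed.

Lemma sum_characters_frobenius n (chi : 'I_n -> A -> R[i]) f :
    (forall i, {morph chi i : x y / x * y}) -> (forall i, chi i 1 = 1) ->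
    (forall x, f x = \sum_i chi i x) ->
  frobenius_homs n f.
Proof.
move=> chiM chi1 fE; split=> [|a].
  by rewrite fE; under eq_bigr do rewrite chi1; rewrite sumr_const card_ord.
rewrite (frobenius_phi_sum chiM fE) big_pred0// => t.
apply/negbTE/negP => /card_uniqP; rewrite size_tuple => tE.
by have := max_card (mem t); rewrite card_ord tE ltnn.
Qed.

Lemma horner_algZ a c (P : {poly R[i]}) :
  horner_alg a (c *: P) = c *: horner_alg a P.
Proof. by rewrite -mul_polyC rmorphM/= horner_algC mulr_algl. Qed.

(** The slots hold the monomials b^L1 a^L2, and b occurs exactly once. Allowing
    powers of a and an arbitrary position for b makes the family stable under
    the merging of two slots in the recursion, which preserves the total
    degree in a: each of the k merged terms contributes -1 times the previous
    leading coefficient. *)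
Lemma frobenius_phi_horner f a k (L : 'I_k.+1 -> nat * nat) :
    (\sum_j (L j).1 = 1)%N -> (forall j, 0 < (L j).1 + (L j).2)%N ->
  exists Q : {poly R[i]},
    [/\ (size Q <= (\sum_j (L j).2).+1)%N,
        Q`_(\sum_j (L j).2)%N = (-1) ^+ k * k`!%:R &
        forall b, frobenius_phi f (fun j => b ^+ (L j).1 * a ^+ (L j).2) =
                  f (horner_alg a Q * b)].
Proof.
elim: k L => [|k IHk] L L1 Lpos.
  rewrite !big_ord1 in L1 *; exists 'X^((L ord0).2).
  split=> [||b]; first by rewrite size_polyXn.
    by rewrite coefXn eqxx expr0 mul1r.
  by rewrite frobenius_phi1 L1 expr1 mulrC rmorphXn/= horner_algX.
pose M (j : 'I_k.+1) := L (lift ord0 j).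
set tot := (\sum_j _)%N.
have totE : tot = ((L ord0).2 + \sum_j (M j).2)%N by rewrite /tot big_ord_recl.
rewrite big_ord_recl -/M in L1.
pose N j := dfwith M j ((L ord0).1 + (M j).1, (L ord0).2 + (M j).2)%N.
have Nsum (u : nat * nat -> nat) j :
    (u ((L ord0).1 + (M j).1, (L ord0).2 + (M j).2) = u (L ord0) + u (M j))%N ->
    (\sum_l u (N j l) = u (L ord0) + \sum_l u (M l))%N.
  by move=> uE; rewrite (big_dfwith _ (fun _ => u))/= uE -addnA [in RHS](bigD1 j).
have Npos j l : (0 < (N j l).1 + (N j l).2)%N.
  rewrite /N dfwithE; case: eqP => _ /=; last exact: Lpos.
  by rewrite addnACA addn_gt0 Lpos.
(* The k+1 terms of the sum keep the total exponent of a. *)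
have /choice[Q HQ] j := IHk (N j) (etrans (@Nsum fst j erefl) L1) (Npos j).
have phiN j b : frobenius_phi f (dfwith (fun l => b ^+ (M l).1 * a ^+ (M l).2) j
      (b ^+ (L ord0).1 * a ^+ (L ord0).2 * (b ^+ (M j).1 * a ^+ (M j).2))) =
    f (horner_alg a (Q j) * b).
  have [_ _ <-] := HQ j; congr frobenius_phi; apply/funext => l.
  by rewrite /N !dfwithE; case: eqP => // _; rewrite mulrACA -!exprD.
(* The leading term comes from the sum alone: the product detaches a slot, and
   the factor without b takes a positive power of a away. *)
have [Q0 [Q0size Q0E]] : exists Q0 : {poly R[i]}, (size Q0 <= tot)%N /\
    forall b, f (b ^+ (L ord0).1 * a ^+ (L ord0).2) *
      frobenius_phi f (fun j => b ^+ (M j).1 * a ^+ (M j).2) =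
      f (horner_alg a Q0 * b).
  case L0E : (L ord0).1 L1 => [|[|//]] /= L1.
    have [P [Psize _ PE]] := IHk M L1 (fun j => Lpos _).
    exists (f (a ^+ (L ord0).2) *: P); split=> [|b].
      rewrite (leq_trans (size_scale_leq _ _))// (leq_trans Psize)// totE.
      by rewrite -add1n leq_add2r; have := Lpos ord0; rewrite L0E.
    by rewrite PE expr0 mul1r horner_algZ -scalerAl linearZ.
  have M1 j : (M j).1 = 0%N.
    by apply/eqP; move: L1; rewrite (bigD1 j)//=; case: (M j).1.
  exists (frobenius_phi f (fun j => a ^+ (M j).2) *: 'X^((L ord0).2)).
  split=> [|b].
    rewrite (leq_trans (size_scale_leq _ _))// size_polyXn totE -addn1 leq_add2l.
    rewrite (bigD1 ord0)//= addn_gt0.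
    by have := Lpos (lift ord0 ord0); rewrite -/(M _) M1 add0n => ->.
  rewrite horner_algZ rmorphXn/= horner_algX -scalerAl linearZ/= expr1 mulrC.
  congr (_ * f _); last by rewrite mulrC.
  by congr frobenius_phi; apply/funext => j; rewrite M1 expr0 mul1r.
have Qtot j : (\sum_l (N j l).2)%N = tot by rewrite (@Nsum snd).
exists (Q0 - \sum_j Q j); split.
- rewrite (leq_trans (size_polyD _ _))// geq_max size_polyN (leq_trans Q0size)//=.
  apply: (leq_trans (size_sum _ _ _)); apply/bigmax_leqP => j _.
  by have [+ _ _] := HQ j; rewrite Qtot.
- rewrite coefB nth_default// sub0r coef_sum.
  under eq_bigr => j _.
    have [_ + _] := HQ j; rewrite Qtot => ->.
    over.
  rewrite sumr_const card_ord -[_ *+ k.+1]mulr_natr -mulrA -natrM mulnC.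
  by rewrite -factS exprS mulN1r mulNr.
- move=> b.
  rewrite (@frobenius_phiS _ _ _ (fun l => b ^+ (M l).1 * a ^+ (M l).2))//.
  under [X in _ - X]eq_bigr do rewrite phiN.
  by rewrite Q0E rmorphB rmorph_sum/= mulrBl mulr_suml linearB/= (linear_sum f).
Qed.

(** The largest ideal contained in the kernel of f. *)
Definition frobenius_ker f a := forall b, f (a * b) = 0.

Lemma frobenius_ker_horner n f a : frobenius_homs n f ->
  exists2 Q : {poly R[i]}, Q != 0 & frobenius_ker f (horner_alg a Q).
Proof.
move=> [_ fn].
pose L (j : 'I_n.+1) := if j == ord0 then (1, 0)%N else (0, 1)%N.
have [||Q [_ Qn QE]] := @frobenius_phi_horner f a n L.
- rewrite big_ord_recl/= big1 ?addn0// => j _; by rewrite /L.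
- by move=> j; rewrite /L; case: ifP.
exists Q; last by move=> b; rewrite -QE fn.
apply: contra_eq_neq Qn => ->; rewrite coef0 eq_sym mulf_eq0 negb_or.
by rewrite signr_eq0 pnatr_eq0 -lt0n fact_gt0.
Qed.

Lemma frobenius_kerMl f a c : frobenius_ker f a -> frobenius_ker f (a * c).
Proof. by move=> aI b; rewrite -mulrA. Qed.

Lemma frobenius_kerMr f a c : frobenius_ker f a -> frobenius_ker f (c * a).
Proof. by rewrite mulrC; exact: frobenius_kerMl. Qed.

Lemma frobenius_kerD f a c :
  frobenius_ker f a -> frobenius_ker f c -> frobenius_ker f (a + c).
Proof. by move=> aI cI b; rewrite mulrDl linearD/= aI cI addr0. Qed.

Lemma frobenius_kerZ f k a : frobenius_ker f a -> frobenius_ker f (k *: a).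
Proof. by move=> aI b; rewrite -scalerAl linearZ/= aI mulr0. Qed.

Lemma frobenius_phi_ker f k (a : 'I_k -> A) j :
  frobenius_ker f (a j) -> frobenius_phi f a = 0.
Proof.
elim: k => [|k IHk] in a j *; first by case: j.
rewrite (@frobenius_phiS _ _ _ (fun l => a (lift ord0 l)))//.
case: (unliftP ord0 j) => [l|] -> aI.
  rewrite (IHk _ l)// mulr0 sub0r big1 ?oppr0// => l' _; apply: (IHk _ l).
  by rewrite dfwithE; case: eqP => // <-; exact: frobenius_kerMr.
have := aI 1; rewrite mulr1 => ->; rewrite mul0r sub0r big1 ?oppr0// => l _.
by apply: (IHk _ l); rewrite dfwithin; exact: frobenius_kerMl.
Qed.

(** Modulo the ideal, merging two slots replaces the product a a by c a, so each
    step of the recursion multiplies by f(a) - k c. The cases c = 0 and c = 1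
    describe square-zero and idempotent elements. *)
Lemma frobenius_phi_quasi_idempotent f a (c : R[i]) k :
    frobenius_ker f (a * a - c *: a) ->
  frobenius_phi f (fun _ : 'I_k => a) = \prod_(i < k) (f a - i%:R * c).
Proof.
move=> aI; elim: k => [|k IHk]; first by rewrite big_ord0.
rewrite (@frobenius_phiS _ _ _ (fun=> a))// big_ord_recr/= -IHk.
have phia (j : 'I_k) : frobenius_phi f (dfwith (fun=> a) j (a * a)) =
    c * frobenius_phi f (fun _ : 'I_k => a).
  rewrite -(subrK (c *: a) (a * a)) [_ + _]addrC frobenius_phi_linear.
  rewrite [X in _ + X](@frobenius_phi_ker _ _ _ j) ?dfwithin// addr0.
  congr (_ * frobenius_phi _ _); apply/funext => l.
  by rewrite dfwithE; case: ifP.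
under eq_bigr do rewrite phia.
by rewrite sumr_const card_ord -[_ *+ k]mulr_natl [k%:R * _]mulrA -mulrBl mulrC.
Qed.

(** Every multiple a b of a is also square-zero modulo the ideal, whence
    0 = f(a b)^(n+1). *)
Lemma frobenius_ker_sqr n f a : frobenius_homs n f ->
  frobenius_ker f (a * a) -> frobenius_ker f a.
Proof.
move=> [_ fn] aI b; have := fn (fun=> a * b).
rewrite (@frobenius_phi_quasi_idempotent _ _ 0) => [|e].
  under eq_bigr do rewrite mulr0 subr0.
  by rewrite prodr_const card_ord => /eqP; rewrite expf_eq0/= => /eqP.
by rewrite scale0r subr0 mulrACA -[_ * _ * e]mulrA aI.
Qed.

Lemma frobenius_ker_nilpotent n f a N : frobenius_homs n f ->
  frobenius_ker f (a ^+ N) -> frobenius_ker f a.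
Proof.
move=> fn aN.
have : frobenius_ker f (a ^+ (2 ^ N)).
  by rewrite -(subnK (ltnW (ltn_expl N (isT : 1 < 2)%N))) exprD;
    exact: frobenius_kerMr.
elim: N {aN} => [|N IHN]; first by rewrite expr1.
rewrite expnS mulnC exprM expr2 => /(frobenius_ker_sqr fn); exact: IHN.
Qed.

Lemma frobenius_idempotent_nat n f a : frobenius_homs n f ->
  frobenius_ker f (a * a - a) -> exists i : 'I_n.+1, f a = i%:R.
Proof.
move=> [_ fn] aI; have := fn (fun=> a).
rewrite (@frobenius_phi_quasi_idempotent _ _ 1) ?scale1r// => /eqP.
rewrite prodf_seq_eq0 => /hasP[i _ /=]; rewrite mulr1 subr_eq0 => /eqP fa.
by exists i.
Qed.

(** An annihilating polynomial of a divides a power of any product of a - z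
    that runs over all its roots; nilpotents lie in the ideal, so the
    product itself does. Any larger list s of values z works, which lets the m
    coordinates share one list. *)
Lemma frobenius_ker_split n f a : frobenius_homs n f ->
  exists r : seq R[i], forall s : seq R[i], {subset r <= s} ->
    frobenius_ker f (\prod_(z <- s) (a - z%:A)).
Proof.
move=> fn; have [Q Q0 QI] := frobenius_ker_horner a fn.
have [r Qr] := closed_field_poly_normal Q.
exists r => s rs; set D := \prod_(z <- s) _.
apply: (@frobenius_ker_nilpotent _ _ _ (size r) fn).
have rI : frobenius_ker f (\prod_(z <- r) (a - z%:A)).
  have := @frobenius_kerZ _ (lead_coef Q)^-1 _ QI.
  rewrite [X in horner_alg _ X]Qr horner_algZ scalerA.
  rewrite mulVf ?lead_coef_eq0// scale1r rmorph_prod/=.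
  congr frobenius_ker; apply: eq_bigr => z _.
  by rewrite rmorphB/= horner_algX horner_algC.
suff [c ->] : exists c, D ^+ size r = (\prod_(z <- r) (a - z%:A)) * c.
  exact: frobenius_kerMl.
elim: r rs {Qr rI} => [|z t IHt] zts; first by exists 1; rewrite big_nil mul1r.
have [|c cE] := IHt; first by move=> w wt; apply: zts; rewrite inE wt orbT.
have zs : z \in s by apply: zts; rewrite mem_head.
exists (c * \prod_(w <- rem z s) (a - w%:A)).
rewrite exprS cE big_cons /D (perm_big _ (perm_to_rem zs)) big_cons/=.
by rewrite -!mulrA; congr (_ * _); rewrite mulrC mulrA.
Qed.

End FrobeniusPhi.

(** * Reconstruction of the points *)

Section Lagrange.
Variables (F : fieldType) (N : nat) (s : N.-tuple F).
Hypotheses (N_gt0 : (0 < N)%N) (s_uniq : uniq s).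

Definition lagrange_poly (i : 'I_N) : {poly F} :=
  (\prod_(j | j != i) (tnth s i - tnth s j))^-1 *:
  \prod_(j | j != i) ('X - (tnth s j)%:P).

Lemma lagrange_polyE i j : (lagrange_poly i).[tnth s j] = (i == j)%:R.
Proof.
rewrite /lagrange_poly hornerZ horner_prod.
under [X in _ * X]eq_bigr do rewrite hornerXsubC.
have [->|ij] := eqVneq i j.
  rewrite mulVf// prodf_seq_neq0; apply/allP => k _; apply/implyP => kj.
  by rewrite subr_eq0 (inj_eq (tuple_uniqP _ s_uniq)) eq_sym.
by rewrite [X in _ * X](bigD1 j) 1?eq_sym//= subrr mul0r mulr0.
Qed.

Lemma XsubC_lagrange_poly i : exists c,
  ('X - (tnth s i)%:P) * lagrange_poly i = c *: \prod_(z <- s) ('X - z%:P).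
Proof.
eexists; rewrite /lagrange_poly -scalerAr; congr (_ *: _).
by rewrite big_tuple [RHS](bigD1 i).
Qed.

Lemma size_lagrange_poly i : (size (lagrange_poly i) <= N)%N.
Proof.
have [c cE] := XsubC_lagrange_poly i.
have [->|l0] := eqVneq (lagrange_poly i) 0; first by rewrite size_poly0.
have := size_scale_leq c (\prod_(z <- s) ('X - z%:P)).
rewrite -cE size_prod_XsubC size_tuple mulrC size_Mmonic ?monicXsubC//.
by rewrite size_XsubC addn2.
Qed.

(** Both sides have degree less than N and agree at N points. *)
Lemma sum_lagrange_poly : \sum_i lagrange_poly i = 1.
Proof.
apply/eqP; rewrite -subr_eq0; apply/eqP.
apply: (@roots_geq_poly_eq0 _ _ s) => //.
  apply/allP => z /tnthP[j ->]; rewrite /root hornerD hornerN hornerC horner_sum.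
  rewrite (bigD1 j)//= lagrange_polyE eqxx big1 ?addr0 ?subrr// => i ij.
  by rewrite lagrange_polyE (negPf ij).
rewrite size_tuple (leq_trans (size_polyD _ _))// geq_max size_polyN size_poly1 N_gt0.
rewrite andbT (leq_trans (size_sum _ _ _))//; apply/bigmax_leqP => i _.
exact: size_lagrange_poly.
Qed.

End Lagrange.

Section FrobeniusPoints.
Variables (R : realType) (n m : nat).
Local Notation C := R[i].
Local Notation A := (mpoly m C).
Local Notation U c := (mpolyX C (mnm1 c)).

Lemma meval_horner_alg (v : 'I_m -> C) c (q : {poly C}) :
  meval v (horner_alg (U c) q : A) = q.[v c].
Proof.
elim/poly_ind: q => [|q z IHq]; first by rewrite !rmorph0 horner0.
rewrite rmorphD rmorphM/= horner_algX horner_algC hornerMXaddC.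
by rewrite mevalD mevalM IHq mevalXU mevalZ meval1 mulr1.
Qed.

(** Modulo the ideal, L is a common eigenvector of the multiplications by the
    coordinates, hence of the multiplication by any polynomial. *)
Lemma frobenius_ker_point (f : linform A) (v : 'I_m -> C) (L : A) :
    (forall c, frobenius_ker f ((U c - (v c)%:A) * L)) ->
  forall p, frobenius_ker f ((p - (meval v p)%:A) * L).
Proof.
move=> UI; set P := fun p : A => frobenius_ker f ((p - (meval v p)%:A) * L).
have P1 : P 1 by move=> b; rewrite meval1 scale1r subrr !mul0r linear0.
have PD p q : P p -> P q -> P (p + q).
  move=> /frobenius_kerD pI /pI; rewrite -mulrDl; congr (frobenius_ker f (_ * _)).
  by rewrite mevalD scalerDl opprD addrACA.
have PZ c p : P p -> P (c *: p).
  move=> /(@frobenius_kerZ _ _ _ c); rewrite scalerAl.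
  by congr (frobenius_ker f (_ * _)); rewrite mevalZ scalerBr scalerA.
have PM p q : P p -> P q -> P (p * q).
  move=> /(@frobenius_kerMl _ _ _ _ q) pI /(@frobenius_kerZ _ _ _ (meval v p)).
  move=> /(frobenius_kerD pI); congr (frobenius_ker f).
  rewrite mulrAC scalerAl -mulrDl; congr (_ * _).
  rewrite mulrBl scalerBr scalerA mevalM mulr_algl.
  by rewrite addrA subrK.
elim/mpolyind => [|c M p _ _ Pp].
  by move=> b; rewrite meval0 scale0r subrr !mul0r linear0.
apply: (PD _ _ _ Pp); apply: PZ; rewrite mpolyXE_id.
apply: (big_ind P P1 PM) => i _.
elim: (M i) => [|k IHk]; first by rewrite expr0.
by rewrite exprS; apply: (PM _ _ _ IHk) => b; rewrite mevalXU UI.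
Qed.

(** The Lagrange polynomials L g of the grid satisfy p L_g = p(g) L_g modulo the
    ideal, so f(p) = sum_g p(g) f(L_g); taking p = L_g shows that L_g is
    idempotent and that f(L_g) is a multiplicity. *)
Theorem frobenius_hom_points (f : linform A) : frobenius_homs n f ->
  exists x : 'I_n -> 'rV[C]_m, forall p, f p = \sum_i meval (x i ord0) p.
Proof.
move=> fn.
have /choice[r rI] c := frobenius_ker_split (U c) fn.
(* The value 0 only ensures that the list is not empty. *)
pose S := undup (0 :: flatten [seq r c | c <- enum 'I_m]).
have SI c : frobenius_ker f (\prod_(z <- S) (U c - z%:A)).
  apply: rI => z zr; rewrite mem_undup inE; apply/orP; right.
  by apply/flattenP; exists (r c) => //; rewrite map_f// mem_enum.
have S_gt0 : (0 < size S)%N.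
  by have : 0 \in S; [rewrite mem_undup mem_head|case: (S)].
pose s := in_tuple S.
have s_uniq : uniq s by exact: undup_uniq.
pose l := lagrange_poly s.
pose G := {ffun 'I_m -> 'I_(size S)}.
pose pt (g : G) c := tnth s (g c).
pose L (g : G) : A := \prod_c horner_alg (U c) (l (g c)).
have L1 : \sum_g L g = 1.
  rewrite -(bigA_distr_bigA (fun c i => horner_alg (U c) (l i))) big1// => c _.
  by rewrite -rmorph_sum/= sum_lagrange_poly// rmorph1.
have LI g : forall p, frobenius_ker f ((p - (meval (pt g) p)%:A) * L g).
  apply: frobenius_ker_point => c; rewrite /L (bigD1 c)//= mulrA.
  apply: frobenius_kerMl; have [k kE] := XsubC_lagrange_poly s (g c).
  have -> : U c - (pt g c)%:A = horner_alg (U c) ('X - (pt g c)%:P) :> A.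
    by rewrite rmorphB/= horner_algX horner_algC.
  rewrite -rmorphM/= kE horner_algZ; apply: frobenius_kerZ.
  rewrite rmorph_prod/=; have := SI c; congr (frobenius_ker f).
  by apply: eq_bigr => z _; rewrite rmorphB/= horner_algX horner_algC.
have Lpt g : meval (pt g) (L g) = 1.
  rewrite /L rmorph_prod big1// => c _.
  by rewrite /= meval_horner_alg lagrange_polyE// eqxx.
have /choice[k kE] g : exists k : 'I_n.+1, f (L g) = k%:R.
  apply: (frobenius_idempotent_nat fn).
  by have := LI g (L g); rewrite Lpt scale1r mulrBl mul1r.
have fE p : f p = \sum_g (k g)%:R * meval (pt g) p.
  rewrite -[in LHS](mulr1 p) -L1 mulr_sumr linear_sum; apply: eq_bigr => g _.
  have /(_ 1) := LI g p; rewrite mulr1 mulrBl linearB/= mulr_algl linearZ/= kE.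
  by move=> /subr0_eq ->; rewrite mulrC.
pose X := flatten [seq nseq (k g) g | g <- enum G].
have XE (V : nmodType) (F : G -> V) : \sum_(g <- X) F g = \sum_g F g *+ k g.
  rewrite big_flatten big_map -[RHS]big_enum/=; apply: eq_bigr => g _.
  by rewrite big_nseq -Monoid.iteropE.
have Xn : size X == n.
  have := fn.1; rewrite fE; under eq_bigr do rewrite meval1 mulr1.
  rewrite -natr_sum => /eqP; rewrite eqr_nat => /eqP <-; apply/eqP.
  by rewrite -sum1_size XE; apply: eq_bigr => g _; rewrite -mulr_natl mulr1 natn.
exists (fun i => \row_c pt (tnth (Tuple Xn) i) c) => p.
rewrite fE -(big_tuple _ _ (Tuple Xn) predT
  (fun g => meval (fun c => (\row_c' pt g c') ord0 c) p))/= XE.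
apply: eq_bigr => g _; rewrite mulr_natl; congr (_ *+ _).
by apply: meval_eq => c; rewrite mxE.
Qed.

End FrobeniusPoints.

(** * Points are determined by the values of polynomials *)

Section Injectivity.
Variables (K : numFieldType) (n m : nat).
Implicit Types (x y : 'I_n -> 'rV[K]_m) (z w : 'rV[K]_m).

Lemma mpoly_separates z (s : seq 'rV[K]_m) : exists p : mpoly m K,
  forall w, (w == z) || (w \in s) -> meval (w ord0) p = (w == z)%:R.
Proof.
elim: s => [|w s [p pE]].
  by exists 1 => w; rewrite orbF meval1 => ->.
have [->|wz] := eqVneq w z.
  by exists p => w' w'E; apply: pE; move: w'E; rewrite inE orbA orbb.
have [c wzc] : exists c, w ord0 c != z ord0 c.
  apply/existsP; apply: contraNT wz => /existsPn wz; apply/eqP/rowP => c.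
  exact/eqP/negPn.
pose d := z ord0 c - w ord0 c.
exists (d^-1 *: (mpolyX K (mnm1 c) - (w ord0 c)%:A) * p) => w' w'E.
rewrite mevalM mevalZ mevalB mevalXU mevalZ meval1 mulr1.
move: w'E; rewrite inE orbCA => /orP[/eqP ->|w'E].
  by rewrite subrr mulr0 mul0r (negPf wz).
rewrite pE//; have [->|_] := eqVneq w' z; last by rewrite mulr0.
by rewrite mulr1 mulVf// subr_eq0 eq_sym.
Qed.

(** A polynomial equal to 1 at z and to 0 at the other points counts the
    occurrences of z in both tuples. *)
Lemma eq_eval_sum_perm x y :
    (forall p, \sum_i meval (x i ord0) p = \sum_i meval (y i ord0) p) ->
  exists s : 'S_n, y = x \o s.
Proof.
move=> xy; pose tx := [tuple x i | i < n]; pose ty := [tuple y i | i < n].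
have /tuple_permP[s sE] : perm_eq ty tx.
  apply/allP => z _ /=; apply/eqP.
  have [p pE] := mpoly_separates z (tx ++ ty).
  have countE u : {subset [tuple u i | i < n] <= tx ++ ty} ->
      (count_mem z [tuple u i | i < n])%:R = \sum_i meval (u i ord0) p :> K.
    move=> uS; rewrite -sum1_count big_mkcond/= big_map big_enum/= natr_sum.
    apply: eq_bigr => i _; rewrite pE; first by case: eqP.
    by rewrite uS ?orbT//; apply/mapP; exists i; rewrite ?mem_enum.
  apply/eqP; rewrite -(eqr_nat K) !countE ?xy// => w; rewrite mem_cat => ->//.
  by rewrite orbT.
exists s; apply/funext => i /=.
have /(congr1 (fun u => nth (y i) u i)) := sE.
by rewrite -!tnth_nth !tnth_mktuple.
Qed.

End Injectivity.

(** * Convergence of power sums along an ultrafilter *)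

Section Limits.
Import numFieldNormedType.Exports.
Variables (K : numFieldType) (T : Type) (F : set_system T).
Context {FF : Filter F}.

Lemma cvg_bounded_mul0 (v w : T -> K) (M : K) : 0 < M ->
    (\forall t \near F, `|v t| <= M) -> w @ F --> 0 ->
  (v t * w t) @[t --> F] --> 0.
Proof.
move=> M0 vM /cvgr0_norm_lt w0; apply/cvgr0Pnorm_lt => e e0.
have {}w0 := w0 (e / M) (divr_gt0 e0 M0); near=> t.
rewrite normrM (@le_lt_trans _ _ (M * `|w t|))//.
  by rewrite ler_wpM2r//; near: t.
by rewrite mulrC -ltr_pdivlMr//; near: t.
Unshelve. all: by end_near. Qed.

Lemma cvg_sumr (I : Type) (r : seq I) (P : pred I) (f : I -> T -> K)
    (a : I -> K) :
    (forall i, P i -> f i @ F --> a i) ->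
  (\sum_(i <- r | P i) f i t) @[t --> F] --> \sum_(i <- r | P i) a i.
Proof.
by move=> fa; exact: (@cvg_big K I +%R 0 P add_continuous T F r f a _ fa).
Qed.

Lemma cvg_prodr (I : Type) (r : seq I) (P : pred I) (f : I -> T -> K)
    (a : I -> K) :
    (forall i, P i -> f i @ F --> a i) ->
  (\prod_(i <- r | P i) f i t) @[t --> F] --> \prod_(i <- r | P i) a i.
Proof.
by move=> fa; exact: (@cvg_big K I *%R 1 P mul_continuous T F r f a _ fa).
Qed.

Lemma meval_cvg m (y : T -> 'I_m -> K) (z : 'I_m -> K) :
    (forall c, y t c @[t --> F] --> z c) ->
  forall p, meval (y t) p @[t --> F] --> meval z p.
Proof.
move=> yz p; under eq_fun do rewrite mevalE; rewrite mevalE.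
apply: cvg_sumr => M _; apply: cvgM; first exact: cvg_cst.
apply: cvg_prodr => c _; elim: (M c) => [|k IHk].
  by rewrite expr0; under eq_fun do rewrite expr0; exact: cvg_cst.
by rewrite exprS; under eq_fun do rewrite exprS; exact: cvgM.
Qed.

End Limits.

Section Ultrafilters.
Import numFieldNormedType.Exports.
Variables (K : numFieldType) (T : Type) (F : set_system T).
Hypothesis FU : UltraFilter F.

Let FP : ProperFilter F := ultra_proper.

Lemma ultra_cvg0_or_away (w : T -> K) :
  w @ F --> 0 \/ exists2 d : K, 0 < d & \forall t \near F, d <= `|w t|.
Proof.
have [|nw] := pselect (w @ F --> 0); [by left|right].
apply: contrapT => nd; apply: nw; apply/cvgr0Pnorm_lt => e e0.
have [//|Fe] := in_ultra_setVsetC [set t | `|w t| < e] FU.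
exfalso; apply: nd; exists e => //; apply: filterS Fe => t /= /negP.
by rewrite -real_leNgt// ?normr_real// gtr0_real.
Qed.

Lemma ultra_prod_cvg0 (I : finType) (f : I -> T -> K) :
    (\prod_i f i t) @[t --> F] --> 0 -> exists i, f i @ F --> 0.
Proof.
move=> f0; apply: contrapT => nf.
have /choice[d dP] i : exists d : K, 0 < d /\ \forall t \near F, d <= `|f i t|.
  have [fi0|[d d0 dP]] := ultra_cvg0_or_away (f i); last by exists d.
  by exfalso; apply: nf; exists i.
have d0 : 0 < \prod_i d i by apply: prodr_gt0 => i _; exact: (dP i).1.
have Fd : \forall t \near F, forall i, d i <= `|f i t|.
  by apply: filter_forall => i; exact: (dP i).2.
move/cvgr0_norm_lt: f0 => /(_ _ d0)/(filterI Fd)/filter_ex[t [/= dt]].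
apply/negP; rewrite -real_leNgt ?normr_real ?gtr0_real// normr_prod.
by apply: ler_prod => i _; rewrite dt ltW//; exact: (dP i).1.
Qed.

(** Let B be the set of the i such that w_i tends to 0; the other w_l stay away
    from 0 and have bounded inverses v_l. Consider
    S = sum_i prod_{l notin B} (1 - w_i v_l).
    The i-th product tends to 1 for i in B and is eventually 0 for the other i,
    so S tends to #|B|. Expanding the products, S is n plus a combination of the
    power sums of degree at least 1 with bounded coefficients, so S tends to n
    and B contains every index. *)
Lemma power_sums_cvg0 n (w : 'I_n -> T -> K) :
    (forall k, (0 < k)%N -> (\sum_i w i t ^+ k) @[t --> F] --> 0) ->
  forall i, w i @ F --> 0.
Proof.
move=> w0; pose B i := `[< w i @ F --> 0 >].
have BP i : ~~ B i ->
    exists2 d : K, 0 < d & \forall t \near F, d <= `|w i t|.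
  by move=> /asboolPn; case: (ultra_cvg0_or_away (w i)).
(* The value 0 turns the factors with l in B into 1. *)
pose v l t := if B l then 0 else (w l t)^-1.
have /choice[M MP] l : exists M : K, 0 < M /\ \forall t \near F, `|v l t| <= M.
  rewrite /v; have [_|/BP[d d0 dw]] := boolP (B l).
    by exists 1; split=> //; apply: nearW => t; rewrite normr0.
  exists d^-1; rewrite invr_gt0; split=> //; apply: filterS dw => t dw.
  by rewrite normfV lef_pV2// posrE// (lt_le_trans d0).
have Mprod (D : {set 'I_n}) :
    \forall t \near F, `|\prod_(l in D) v l t| <= \prod_(l in D) M l.
  have : \forall t \near F, forall l, `|v l t| <= M l.
    by apply: filter_forall => l; exact: (MP l).2.
  apply: filterS => t vM; rewrite normr_prod; apply: ler_prod => l _.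
  by rewrite normr_ge0 vM.
have Mprod0 (D : {set 'I_n}) : 0 < \prod_(l in D) M l.
  by apply: prodr_gt0 => l _; exact: (MP l).1.
pose S t := \sum_i \prod_l (1 - w i t * v l t).
have Sn : S @ F --> (n%:R : K).
  have SE t : S t = \sum_(D : {set 'I_n}) (\prod_(l in D) v l t) *
      ((-1) ^+ #|D| * \sum_i w i t ^+ #|D|).
    rewrite /S; under [RHS]eq_bigr do rewrite mulrCA mulr_sumr mulr_sumr.
    rewrite exchange_big/=; apply: eq_bigr => i _.
    under eq_bigr do rewrite addrC.
    rewrite bigA_distr; apply: eq_bigr => D _; rewrite -big_mkcond/=.
    under eq_bigr do rewrite -mulNr.
    rewrite big_split/= prodr_const -mulN1r exprMn -mulrA.
    by congr (_ * _); rewrite mulrC.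
  have -> : n%:R =
      \sum_(D : {set 'I_n}) (if D == finset.set0 then n%:R else 0) :> K.
    by rewrite -big_mkcond big_pred1_eq.
  rewrite (funext SE).
  apply: cvg_sumr => D _; case: (eqVneq D finset.set0) => [->|D0].
    rewrite cards0; under eq_fun => t.
      rewrite big_set0 expr0 !mul1r; under eq_bigr do rewrite expr0.
      rewrite sumr_const card_ord; over.
    exact: cvg_cst.
  apply: (cvg_bounded_mul0 (Mprod0 D) (Mprod D)).
  rewrite -[X in _ --> X](mulr0 ((-1) ^+ #|D|)).
  apply: cvgM; first exact: cvg_cst.
  by apply: w0; rewrite lt0n cards_eq0.
have SB : S @ F --> \sum_i ((B i)%:R : K).
  apply: cvg_sumr => i _; have [Bi|Bi] := boolP (B i).
    rewrite -[X in _ --> X](_ : \prod_(l < n) (1 - 0) = 1); last first.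
      by rewrite big1// => l _; rewrite subr0.
    apply: cvg_prodr => l _; apply: cvgB; first exact: cvg_cst.
    under eq_fun do rewrite mulrC.
    apply: (cvg_bounded_mul0 (MP l).1 (MP l).2); exact/asboolP.
  apply: cvg_near_cst; have [d d0] := BP _ Bi; apply: filterS => t dw.
  rewrite (bigD1 i)//= /v (negPf Bi) divff ?subrr ?mul0r//.
  by rewrite -normr_gt0 (lt_le_trans d0).
have nB : n = (\sum_i B i)%N.
  apply/eqP; rewrite -(eqr_nat K) natr_sum; apply/eqP.
  exact: (cvg_unique _ Sn SB).
move=> i; apply/asboolP.
have : (\sum_i ~~ B i + \sum_i B i = n)%N.
  rewrite -big_split/=; transitivity (\sum_(j < n) 1)%N.
    by apply: eq_bigr => j _; case: (B j).
  by rewrite sum1_card card_ord.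
rewrite -nB => /eqP; rewrite -[eqbRHS]add0n eqn_add2r sum_nat_eq0.
move=> /forallP/(_ i)/=.
by rewrite eqb0 negbK.
Qed.

(** For the coordinate c, the polynomial g vanishes at each x_l, so the power
    sums of the g(y_i) tend to 0. *)
Lemma eval_sum_cvg_points n m (y : T -> 'I_n -> 'rV[K]_m)
    (x : 'I_n -> 'rV[K]_m) :
    (forall p, (\sum_i meval (y t i ord0) p) @[t --> F] -->
               \sum_i meval (x i ord0) p) ->
  exists z : 'I_n -> 'rV[K]_m,
    (forall i c, y t i ord0 c @[t --> F] --> z i ord0 c) /\
    forall p, \sum_i meval (z i ord0) p = \sum_i meval (x i ord0) p.
Proof.
move=> yx.
have /choice[z zP] i : exists z : 'rV[K]_m,
    forall c, y t i ord0 c @[t --> F] --> z ord0 c.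
  suff /choice[l lP] c : exists l, y t i ord0 c @[t --> F] --> x l ord0 c.
    by exists (\row_c x (l c) ord0 c) => c; rewrite mxE.
  pose g := \prod_l (mpolyX K (mnm1 c) - (x l ord0 c)%:A).
  have gE (v : 'I_m -> K) : meval v g = \prod_l (v c - x l ord0 c).
    rewrite rmorph_prod; apply: eq_bigr => l _ /=.
    by rewrite mevalB mevalXU mevalZ meval1 mulr1.
  have gpow k (v : 'I_m -> K) : meval v (g ^+ k) = meval v g ^+ k.
    exact: rmorphXn.
  have /(_ i) : forall j, meval (y t j ord0) g @[t --> F] --> 0.
    apply: power_sums_cvg0 => k k0; have := yx (g ^+ k).
    rewrite [X in _ --> X]big1 => [|l _]; last first.
      by rewrite gpow gE (bigD1 l)//= subrr mul0r expr0n eqn0Ngt k0.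
    by under eq_fun do under eq_bigr do rewrite gpow.
  under eq_fun do rewrite gE.
  move=> /ultra_prod_cvg0[l /cvgD/(_ (cvg_cst (x l ord0 c)))].
  rewrite add0r => yl; exists l; apply: cvg_trans yl; apply: near_eq_cvg.
  by near=> t => /=; rewrite subrK.
exists z; split=> // p.
have yz : (\sum_i meval (y t i ord0) p) @[t --> F] -->
    \sum_i meval (z i ord0) p.
  by apply: cvg_sumr => i _; exact: meval_cvg.
exact: (cvg_unique _ yz (yx p)).
Unshelve. all: by end_near. Qed.

End Ultrafilters.

(** * The evaluation map is a homeomorphism *)

Section NormConvergence.
Import numFieldNormedType.Exports.
Variables (K : numFieldType) (T : Type).
Implicit Types (F : set_system T) (f : T -> K) (l : K).

(** Convergence for the modulus, stated without a topology on K: it transfers the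
    limits computed for the norm topology of a numeric field to the topology
    of R[i], without comparing the two structures. *)
Definition norm_cvg F f l :=
  forall e, 0 < e -> \forall t \near F, `|l - f t| < e.

Lemma norm_cvgP F {FF : Filter F} f l : f @ F --> l <-> norm_cvg F f l.
Proof. exact: cvgrPdist_lt. Qed.

Lemma norm_cvg_eval_sum n m F {FF : Filter F} (y : T -> 'I_n -> 'rV[K]_m)
    (z : 'I_n -> 'rV[K]_m) :
    (forall i c, norm_cvg F (fun t => y t i ord0 c) (z i ord0 c)) ->
  forall p, norm_cvg F (fun t => \sum_i meval (y t i ord0) p)
                       (\sum_i meval (z i ord0) p).
Proof.
move=> yz p; apply/norm_cvgP; apply: cvg_sumr => i _.
by apply: meval_cvg => c; apply/norm_cvgP.
Qed.

Lemma norm_cvg_points n m F {FU : UltraFilter F} (y : T -> 'I_n -> 'rV[K]_m)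
    (x : 'I_n -> 'rV[K]_m) :
    (forall p, norm_cvg F (fun t => \sum_i meval (y t i ord0) p)
                          (\sum_i meval (x i ord0) p)) ->
  exists z : 'I_n -> 'rV[K]_m,
    (forall i c, norm_cvg F (fun t => y t i ord0 c) (z i ord0 c)) /\
    forall p, \sum_i meval (z i ord0) p = \sum_i meval (x i ord0) p.
Proof.
move=> yx; have [p|z [yz zx]] := @eval_sum_cvg_points _ _ _ FU _ _ y x.
  exact/norm_cvgP.
by exists z; split=> // i c; apply/norm_cvgP.
Qed.

End NormConvergence.

Section CoarsestTopologies.

Lemma initial_cvgP (S : choiceType) (U : topologicalType) (f : S -> U)
    (F : set_system S) {FF : Filter F} (s : S) :
  F --> (s : initial_topology f) <-> f @ F --> f s.
Proof.
split=> [Fs|fs W [_ /= [[O oO <-]] /= Ofs]].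
  exact: (cvg_comp _ _ Fs (@initial_continuous _ _ f s)).
by move=> /filterS; apply; apply: fs; exact: open_nbhs_nbhs.
Qed.

Lemma ptws_cvgP (I : Type) (U : topologicalType) (F : set_system {ptws I -> U})
    {FF : Filter F} (x : {ptws I -> U}) :
  F --> x <-> forall i, (fun y : {ptws I -> U} => y i) @ F --> x i.
Proof.
split=> [/cvg_sup Fx i|Fx].
  by have := Fx i; move/initial_cvgP.
by apply/cvg_sup => i; apply/initial_cvgP; exact: Fx.
Qed.

End CoarsestTopologies.

Section Topology.
Variables (R : realType) (n m : nat).
Local Notation C := R[i].
Local Notation A := (mpoly m C).
Local Notation V := 'rV[C]_m.
Local Notation Phi := (set_type (@frobenius_homs R A n)).

Lemma complex_cvgP T (F : set_system T) {FF : Filter F} (f : T -> C) (l : C) :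
  f @ F --> l <-> norm_cvg F f l.
Proof.
split=> [/cvg_ballP fl e e0|fl]; first exact: fl.
by apply/cvg_ballP => e e0; exact: fl.
Qed.

Lemma row_cvgP T (F : set_system T) {FF : Filter F} (y : T -> V) (z : V) :
  y @ F --> z <-> forall c, norm_cvg F (fun t => y t ord0 c) (z ord0 c).
Proof.
split=> [yz c|yz U [P zP PU]].
  apply/complex_cvgP => W zW; apply: (yz [set M : V | W (M ord0 c)]).
  exists (fun i j => if j == c then W else setT).
    by move=> i j; case: eqP => [->|_]; [rewrite ord1|exact: filterT].
  by move=> M /(_ ord0 c); rewrite eqxx.
apply: (@filterS _ F _ [set t | forall c, P ord0 c (y t ord0 c)]).
  by move=> t yP; apply: PU => j c; rewrite !ord1.
by apply: filter_forall => c; have /complex_cvgP := yz c; apply; exact: zP.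
Qed.

Lemma points_cvgP T (F : set_system T) {FF : Filter F}
    (y : T -> {ptws 'I_n -> V}) (z : {ptws 'I_n -> V}) :
  y @ F --> z <->
  forall i c, norm_cvg F (fun t => y t i ord0 c) (z i ord0 c).
Proof.
split=> [/ptws_cvgP yz i|yz]; first exact/row_cvgP/yz.
by apply/ptws_cvgP => i; apply/row_cvgP; exact: yz.
Qed.

Lemma frobenius_hom_cvgP T (F : set_system T) {FF : Filter F}
    (f : T -> Phi) (g : Phi) :
  f @ F --> g <->
  forall p : A, norm_cvg F (fun t => set_val (f t) p) (set_val g p).
Proof.
split=> [/initial_cvgP/initial_cvgP/ptws_cvgP fg p|fg].
  exact/complex_cvgP/fg.
apply/initial_cvgP/initial_cvgP/ptws_cvgP => p; apply/complex_cvgP; exact: fg.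
Qed.

(** The proofs of additivity and homogeneity packed in a linear form are
    irrelevant. *)
Lemma linform_ext (f g : linform A) : (forall p, f p = g p) -> f = g.
Proof.
case: f g => [f [[f1] [f2]]] [g [[g1] [g2]]] /= /funext fg.
by subst g; congr GRing.Linear.Pack; congr GRing.Linear.Class;
  [congr Algebra.isNmodMorphism.Axioms_|congr GRing.isScalable.Axioms_];
  exact: Prop_irrelevance.
Qed.

Lemma eval_map_frobenius (z : symPower n V) : frobenius_homs n (eval_map z).
Proof.
apply: (@sum_characters_frobenius _ _ _ (fun i => meval (repr z i ord0))) => //.
- by move=> i p q; rewrite mevalM.
- by move=> i; rewrite meval1.
Qed.

Definition eval_hom (z : symPower n V) : Phi :=
  exist _ (eval_map z : linform A) (mem_set (eval_map_frobenius z)).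

Lemma eval_sum_pi_inj (x y : {ptws 'I_n -> V}) :
    (forall p : A, \sum_i meval (x i ord0) p = \sum_i meval (y i ord0) p) ->
  \pi_(symPower n V) x = \pi_(symPower n V) y.
Proof.
by move=> /eq_eval_sum_perm xy; apply/eqmodP/asboolP.
Qed.

Lemma eval_hom_continuous : continuous eval_hom.
Proof.
apply/quotient_continuous => x; have xF : Filter (nbhs x) := nbhs_filter x.
apply/frobenius_hom_cvgP => p.
have xx := (@points_cvgP _ _ xF id x).1 (fun W xW => xW).
move=> e e0; have := norm_cvg_eval_sum (FF := xF) xx p e0.
apply: (@filterS _ _ xF) => y.
by rewrite !eval_map_pi.
Qed.

(** If the preimage of a neighbourhood of u is not in F, then its complement
    and F generate a proper filter, which some ultrafilter refines. *)
Lemma ultra_cvg (S : Type) (U : topologicalType) (f : S -> U)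
    (F : set_system S) (u : U) :
    Filter F ->
    (forall G, UltraFilter G -> F `<=` G -> f @ G --> u) ->
  f @ F --> u.
Proof.
move=> FF fu W uW; apply: contrapT => nW.
have HP : ProperFilter (within (~` (f @^-1` W)) F).
  split; last exact: within_filter.
  by move=> H0; apply: nW; apply: (@filterS _ _ FF _ _ _ H0) => s; exact: contrapT.
have [G [GU HG]] := ultraFilterLemma HP.
have FG : F `<=` G.
  by move=> B FB; apply: HG; apply: filterS FB.
have GW : G (f @^-1` W) by exact: (fu G GU FG).
have GnW : G (~` (f @^-1` W)) by apply: HG; exact: withinT.
have GP : ProperFilter G := ultra_proper.
by have /filter_ex[s []] : G (f @^-1` W `&` ~` (f @^-1` W)) by exact: filterI.
Qed.

Lemma eval_hom_homeomorphism : homeomorphism eval_hom.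
Proof.
have /choice[x xE] (f : Phi) : exists x : {ptws 'I_n -> V},
    forall p, set_val f p = \sum_i meval (x i ord0) p.
  exact/frobenius_hom_points/set_valP.
exists (fun f => \pi_(symPower n V) (x f)); split.
- move=> z; rewrite -[RHS]reprK; apply: eval_sum_pi_inj => p.
  by rewrite -xE.
- move=> f; apply: val_inj; apply: linform_ext => p.
  by rewrite eval_map_pi -xE.
- exact: eval_hom_continuous.
move=> f; apply: (ultra_cvg (nbhs_filter f)) => G GU fG.
have yx p : norm_cvg G (fun g => \sum_i meval (x g i ord0) p)
    (\sum_i meval (x f i ord0) p).
  have /frobenius_hom_cvgP/(_ p) : (fun g : Phi => g) @ G --> f by [].
  by rewrite -xE; congr (norm_cvg G _ _); apply/funext => g; rewrite xE.
have [z [yz zx]] := norm_cvg_points yx.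
rewrite -(eval_sum_pi_inj zx).
have : x @ G --> (z : {ptws 'I_n -> V}) by apply/points_cvgP.
by move/cvg_comp; apply; exact: pi_continuous.
Qed.

End Topology.

Theorem theorem11 (R : realType) (n m : nat) (n_ge1 : (1 <= n)%N)
    (m_ge1 : (1 <= m)%N) :
  (forall (x : {ptws 'I_n -> 'rV[R[i]]_m}) (p : mpoly m R[i]),
     eval_map (\pi_(symPower n 'rV[R[i]]_m) x) p
     = \sum_(i < n) meval (x i ord0) p)
  /\ exists h : symPower n 'rV[R[i]]_m ->
                set_type (@frobenius_homs R (mpoly m R[i]) n),
       (forall z, set_val (h z) = eval_map z) /\ homeomorphism h.
Proof.
split; first exact: eval_map_pi.
by exists (@eval_hom R n m); split=> //; exact: eval_hom_homeomorphism.
Qed.
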